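(* Let $f\in\mathcal M(\mathbf R)$, and suppose that $d_j=u_j-\mathbf E_{j-1}u_j$, $j=1,2,\ldots$, for some integrable real random variables $u_j$ such that, with $u^*=\sup_{j\ge1}|u_j|$, one has $\|u^*\|_\infty\le a$ and $\left\|\sum_{j=1}^\infty\mathbf E_{j-1}u_j^2\right\|_\infty\le b^2$ for some $a>0$, $b>0$. Then for all $r\ge0$, $$\mathbf{Pr}(f^*_+\ge r)\le\exp\left[\frac ra-\left(\frac ra+\frac{b^2}{a^2}\right)\ln\left(1+\frac{ra}{b^2}\right)\right]\le\left(\frac{eb^2}{ra}\right)^{r/a},$$ where for $r=0$ the last expression is read as $1$.
   Context: $\mathcal M(\mathbf R)$ is the class of all real-valued martingales $f=(f_0,f_1,\ldots)$ with $f_0\equiv0$ on some probability space with respect to some filtration $(F_0,F_1,\ldots)$ (both may depend on $f$). Put $d_j=f_j-f_{j-1}$ for $j\ge1$ and $f^*_+=\sup_{j\ge0}f_j$; $\mathbf E_{j-1}$ is the conditional expectation given $F_{j-1}$; $\|\cdot\|_\infty$ of a random variable is its essential supremum norm. *)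

(* Defs.v *)
From HB Require Import structures.
From mathcomp Require Import all_boot all_order all_algebra.
From mathcomp Require Import all_classical all_reals all_analysis.
Set Implicit Arguments.
Unset Strict Implicit.
Unset Printing Implicit Defensive.
Import Order.TTheory GRing.Theory Num.Theory.
Local Open Scope classical_set_scope.
Local Open Scope ring_scope.

Definition filtration d (T : measurableType d) (F : nat -> set_system T) : Prop :=
  [/\ forall n, sigma_algebra [set: T] (F n),
      forall n, F n `<=` measurable
    & forall n, F n `<=` F n.+1].

Definition measurable_wrt d (T : measurableType d) (R : realType)
    (G : set_system T) (X : T -> R) : Prop :=
  forall B : set R, measurable B -> G (X @^-1` B).

(* [Y] is a version of the conditional expectation E[X | G] (unique up to
   almost sure equality) of the integrable random variable [X]. *)
Definition is_cond_exp d (T : measurableType d) (R : realType)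
    (P : probability T R) (G : set_system T) (X Y : T -> R) : Prop :=
  [/\ P.-integrable [set: T] (EFin \o X),
      measurable_wrt G Y,
      P.-integrable [set: T] (EFin \o Y)
    & forall A, G A ->
        (\int[P]_(x in A) (Y x)%:E = \int[P]_(x in A) (X x)%:E)%E].

Definition martingale d (T : measurableType d) (R : realType)
    (P : probability T R) (F : nat -> set_system T) (f : nat -> T -> R) : Prop :=
  [/\ forall n, measurable_wrt (F n) (f n),
      forall n, P.-integrable [set: T] (EFin \o f n)
    & forall n, is_cond_exp P (F n) (f n.+1) (f n)].

(* The suprema are pointwise and taken in the extended reals, as they may be
   infinite at some points. *)
Definition sup_pos (T : Type) (R : realType) (f : nat -> T -> R) (x : T)
    : \bar R :=
  ereal_sup [set (f j x)%:E | j in [set: nat]].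

Definition sup_abs1 (T : Type) (R : realType) (u : nat -> T -> R) (x : T)
    : \bar R :=
  ereal_sup [set `|u j x|%:E | j in [set j | (1 <= j)%N]].

(* Main.v *)
Require Import Defs.
From HB Require Import structures.
From mathcomp Require Import all_boot all_order all_algebra.
From mathcomp Require Import all_classical all_reals all_analysis.
From mathcomp Require Import measurable_realfun ess_sup_inf.
From mathcomp Require Import ring lra.
Set Implicit Arguments.
Unset Strict Implicit.
Unset Printing Implicit Defensive.
Import Order.TTheory GRing.Theory Num.Theory.
Import numFieldNormedType.Exports.
Local Open Scope classical_set_scope.
Local Open Scope ring_scope.

(** Bennett's inequality in its martingale form, by an exponential
    supermartingale.  Fix [l >= 0] and let [psi = (e^(la) - 1 - la) / a^2]
    ([bennett_coef]).  Two bounds are combined.  From above, [e^(lu)] is at most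
    [1 + lu + psi u^2] as soon as [|u| <= a] ([expR_quad_le]); from below,
    [1 + y <= e^y].  Taking conditional expectations in the first and applying
    the second to the result gives
    [E(e^(l u_j) | F_(j-1)) <= e^(l v_j + psi w_j)], where [v_j] and [w_j] are
    the conditional expectations of [u_j] and [u_j^2]
    ([integral_expR_le_cond_exp]).  The increment [d_j = u_j - v_j] thus
    satisfies [E(e^(l d_j) | F_(j-1)) <= e^(psi w_j)]: the centring term [v_j]
    cancels exactly, so that bounds on the [u_j] and their second moments, not
    on the [d_j], are what the argument uses.

    Hence [M_n = exp (l f_n - psi (w_1 + ... + w_n))] is a positive
    supermartingale with [M_0 = 1] ([exp_supermartingale_super]).  Where
    [w_1 + w_2 + ...] is at most [b^2] and some [f_n] exceeds [s], that [M_n]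
    is at least [e^(l s - psi b^2)], because the [w_j] are nonnegative
    ([is_cond_exp_ge0]) and so have partial sums at most [b^2]; the maximal
    inequality ([supermartingale_maximal_inequality]) bounds the probability of
    this by [e^(psi b^2 - l s)]; letting [s] increase to [r] handles a supremum that is
    not attained ([exponential_tail_bound]).  The best choice,
    [l = ln (1 + ra / b^2) / a], turns the exponent into the one of the
    statement ([bennett_exponentE]), and the second inequality is elementary
    ([bennett_le_powR]).

    Conditional expectations enter only through inequalities between integrals
    over the sets of a sub-sigma-algebra [G].  To multiply them by a
    [G]-measurable factor, [G] is turned into the measurable structure
    [g_sigma_algebraType G] on the same points, so that the approximation by
    simple functions applies to the factor ([ge0_integral_mul_le_sub]). *)

(** * The quadratic bound on the exponential *)

(** In the power series of [e^y - 1 - y] every exponent is at least 2, so each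
    term of the left-hand side is the corresponding term of the right-hand side
    times a power of [x / a]. *)
Lemma expR_quad_le (R : realType) (l a x : R) : 0 <= l -> `|x| <= a ->
  a ^+ 2 * (expR (l * x) - 1 - l * x) <= x ^+ 2 * (expR (l * a) - 1 - l * a).
Proof.
move=> l0 xa; have a0 : 0 <= a := le_trans (normr_ge0 _) xa.
pose S y n : R := series (exp_coeff y) n - 1 - y.
have cvgS y : S y n @[n --> \oo] --> expR y - 1 - y.
  apply: cvgB; last exact: cvg_cst.
  by apply: cvgB; [exact: is_cvg_series_exp_coeff | exact: cvg_cst].
have SE y n : S y n.+2 = \sum_(0 <= k < n) y ^+ k.+2 / k.+2`!%:R.
  rewrite /S /series /= !big_nat_recl//= /exp_coeff/= expr0 expr1 !divr1; ring.
have cvgMS k y : k * S y n @[n --> \oo] --> k * (expR y - 1 - y).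
  by apply: cvgM; [exact: cvg_cst | exact: cvgS].
apply: (ler_cvg_to (cvgMS _ _) (cvgMS _ _)); near=> n.
(* [SE] needs the terms of index 0 and 1 to be present. *)
have [m ->] : exists m, n = m.+2.
  by exists n.-2; rewrite -[LHS](@subnK 2) ?addn2 ?subn2//; near: n; exists 2.
rewrite !SE !mulr_sumr; apply: ler_sum => k _.
rewrite [in leLHS]mulrA [in leRHS]mulrA ler_wpM2r ?invr_ge0//.
rewrite !exprMn [in leLHS]mulrA [in leRHS]mulrA.
have -> : a ^+ 2 * l ^+ k.+2 * x ^+ k.+2 =
    (a ^+ 2 * x ^+ 2 * l ^+ k.+2) * x ^+ k.
  rewrite -[k.+2]addn2 !exprD; ring.
have -> : x ^+ 2 * l ^+ k.+2 * a ^+ k.+2 =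
    (a ^+ 2 * x ^+ 2 * l ^+ k.+2) * a ^+ k.
  rewrite -[k.+2]addn2 !exprD; ring.
apply: ler_wpM2l.
  apply: mulr_ge0; last exact: exprn_ge0.
  by apply: mulr_ge0; exact: sqr_ge0.
apply: (le_trans (ler_norm _)); rewrite normrX.
by apply: lerXn2r => //; rewrite nnegrE.
Unshelve. all: by end_near. Qed.

(** * Integrals against factors measurable for a sub-sigma-algebra *)

Section sub_sigma_algebra.
Context (R : realType) (d : measure_display) (T : measurableType d).
Variables (mu : {measure set T -> \bar R}) (G : set_system T).
Hypotheses (sG : sigma_algebra [set: T] G) (mG : G `<=` measurable).

Lemma measurable_subE (A : set T) :
  measurable (A : set (g_sigma_algebraType G)) <-> G A.
Proof. by rewrite -[in X in _ <-> X](measurable_g_measurableTypeE sG). Qed.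

Lemma sub_measurable_fun (d' : measure_display) (U : measurableType d')
    (f : T -> U) :
  measurable_fun [set: g_sigma_algebraType G] f -> measurable_fun [set: T] f.
Proof.
by move=> mf _ B mB; apply: mG; apply/measurable_subE; exact: mf.
Qed.

Import HBNNSimple.

(** The level sets of [h] belong to [G], so this reduces the integral to
    integrals of [X] over sets of [G]. *)
Lemma integral_nnsfun_mul (h : {nnsfun (g_sigma_algebraType G) >-> R})
    (X : T -> R) : (forall x, 0 <= X x) -> measurable_fun [set: T] X ->
  (\int[mu]_x (h x * X x)%:E =
   \sum_(y \in range h) y%:E * \int[mu]_(x in h @^-1` [set y]) (X x)%:E)%E.
Proof.
move=> X0 mX.
have mh y : measurable (h @^-1` [set y] : set T).
  by apply: mG; apply/measurable_subE; exact: measurable_sfunP.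
under eq_integral => x _.
  rewrite EFinM fimfunE -fsumEFin// ge0_mule_fsuml; last first.
    by move=> y; exact: nnfun_muleindic_ge0.
  over.
rewrite /= ge0_integral_fsum//; last 2 first.
- move=> y; apply/measurable_EFinP; apply: measurable_funM => //.
  by apply: measurable_funM => //; exact: measurable_indic.
- move=> y x _; apply: mule_ge0; last by rewrite lee_fin.
  exact: nnfun_muleindic_ge0.
apply: eq_fsbigr => y yh.
have y0 : 0 <= y by move: yh; rewrite inE => -[t _ <-].
under eq_integral do rewrite -EFinM -mulrA EFinM.
rewrite (@ge0_integralZl_EFin _ _ _ mu _ measurableT
  (fun x => (\1_(h @^-1` [set y]) x * X x)%:E))//; last 2 first.
- by move=> x _; rewrite lee_fin mulr_ge0.
- by apply/measurable_EFinP/measurable_funM => //; exact: measurable_indic.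
congr (_ * _)%E; rewrite [RHS]integral_mkcond epatch_indic.
by apply: eq_integral => x _; rewrite /= -EFinM mulrC.
Qed.

(** An inequality between integrals over all sets of [G] extends, by linearity,
    to weights that are simple functions for [G], and by monotone convergence to
    all nonnegative [G]-measurable weights. For conditional expectations this is
    the rule of taking out what is known; an inequality is enough here and
    allows [Y] to be replaced by any positive upper bound. *)
Lemma ge0_integral_mul_le_sub (X Y Z : T -> R) :
  (forall x, 0 <= X x) -> measurable_fun [set: T] X ->
  (forall x, 0 <= Y x) -> measurable_fun [set: T] Y ->
  (forall A, G A ->
     (\int[mu]_(x in A) (X x)%:E <= \int[mu]_(x in A) (Y x)%:E)%E) ->
  (forall x, 0 <= Z x) -> measurable_fun [set: g_sigma_algebraType G] Z ->
  (\int[mu]_x (Z x * X x)%:E <= \int[mu]_x (Z x * Y x)%:E)%E.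
Proof.
move=> X0 mX Y0 mY XY Z0 mZ.
have mZE : measurable_fun [set: g_sigma_algebraType G] (EFin \o Z).
  exact/measurable_EFinP.
pose h := nnsfun_approx measurableT mZE.
have hZ x : EFin \o h^~ x @ \oo --> (Z x)%:E.
  by apply: (cvg_nnsfun_approx measurableT mZE) => // y _; rewrite lee_fin.
have intE (W : T -> R) : (forall x, 0 <= W x) -> measurable_fun [set: T] W ->
    (\int[mu]_x (h n x * W x)%:E @[n --> \oo] --> \int[mu]_x (Z x * W x)%:E)%E.
  move=> W0 mW.
  have -> : (\int[mu]_x (Z x * W x)%:E =
      \int[mu]_x limn (fun n => (h n x * W x)%:E))%E.
    apply: eq_integral => x _; apply/esym/cvg_lim => //.
    under eq_fun do rewrite EFinM.
    by rewrite EFinM; apply: cvgeZr => //; exact: hZ.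
  apply: cvg_monotone_convergence => //.
  - move=> n; apply/measurable_EFinP; apply: measurable_funM => //.
    by apply: sub_measurable_fun; exact: measurable_funP.
  - by move=> n x _; rewrite lee_fin mulr_ge0.
  - move=> x _ m n mn; rewrite lee_fin ler_wpM2r//.
    by have /lefP := nd_nnsfun_approx measurableT mZE mn; exact.
apply: (lee_cvg_to (intE _ X0 mX) (intE _ Y0 mY)); near=> n.
rewrite !integral_nnsfun_mul//; apply: lee_fsum => // y [t _ <-].
apply: lee_wpmul2l; first by rewrite lee_fin.
by apply: XY; apply/measurable_subE; exact: measurable_sfunP.
Unshelve. all: by end_near. Qed.

End sub_sigma_algebra.

Lemma measurable_wrtP (R : realType) (d : measure_display)
    (T : measurableType d) (G : set_system T) (X : T -> R) :
  sigma_algebra [set: T] G ->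
  measurable_wrt G X <-> measurable_fun [set: g_sigma_algebraType G] X.
Proof.
move=> sG; split=> [mX _ B mB|mX B mB].
  by apply/(measurable_subE sG); rewrite setTI; exact: mX.
by apply/(measurable_subE sG); rewrite -[X in measurable X]setTI; exact: mX.
Qed.

(** * The maximal inequality for nonnegative supermartingales *)

Section maximal_inequality.
Context (R : realType) (d : measure_display) (T : measurableType d).
Variables (mu : {measure set T -> \bar R}) (F : nat -> set_system T).
Hypothesis hF : filtration F.
Variable M : nat -> T -> R.
Hypotheses (M_ge0 : forall n x, 0 <= M n x)
  (M_adapted : forall n, measurable_wrt (F n) (M n))
  (M_super : forall n A, F n A ->
     (\int[mu]_(x in A) (M n.+1 x)%:E <= \int[mu]_(x in A) (M n x)%:E)%E).
Variable c : R.
Hypothesis c_ge0 : 0 <= c.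

Let sF n : sigma_algebra [set: T] (F n). Proof. by have [+ _ _] := hF. Qed.
Let mF n : F n `<=` measurable. Proof. by have [_ + _] := hF. Qed.

Let E n : set T := [set x | c <= M n x].
Let B n : set T := \big[setU/set0]_(i < n.+1) E i.

Let FE n : F n (E n).
Proof.
have -> : E n = M n @^-1` `[c, +oo[.
  by apply/seteqP; split=> x /=; rewrite in_itv/= andbT.
by apply: M_adapted; exact: measurable_itv.
Qed.

Let FB n : F n (B n).
Proof.
elim: n => [|n IH]; first by rewrite /B big_ord1; exact: FE.
apply/(measurable_subE (sF _)); rewrite /B big_ord_recr/=.
apply: measurableU; apply/(measurable_subE (sF _)); last exact: FE.
by have [_ _] := hF; apply.
Qed.

Let mM n : measurable_fun [set: T] (M n).
Proof.
apply: (sub_measurable_fun (sF n) (mF (n := n))).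
exact/(measurable_wrtP _ (sF n)).
Qed.

Let cE_le n A : measurable A -> A `<=` E n ->
  (c%:E * mu A <= \int[mu]_(x in A) (M n x)%:E)%E.
Proof.
move=> mA AE; rewrite -integral_cst//; apply: ge0_le_integral => //.
by apply/measurable_EFinP; exact: measurable_funTS.
Qed.

Let integralUI n (A A1 A2 : set T) : measurable A1 -> measurable A2 ->
  A1 `|` A2 = A -> A1 `&` A2 = set0 ->
  (\int[mu]_(x in A1) (M n x)%:E + \int[mu]_(x in A2) (M n x)%:E =
   \int[mu]_(x in A) (M n x)%:E)%E.
Proof.
move=> mA1 mA2 <- A12; rewrite ge0_integral_setU//.
- by apply/measurable_EFinP; exact: measurable_funTS.
- by move=> x _; rewrite lee_fin.
- by apply/disj_setPS; rewrite A12.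
Qed.

(** The left-hand side bounds from below the expectation of the process stopped
    on reaching [c]; stating the supermartingale property on sets lets the
    induction on [n] work without stopping times: the part of the complement of
    [B n] where [M n.+1 >= c] moves from the second term to the first. *)
Let stopped_bound n :
  (c%:E * mu (B n) + \int[mu]_(x in ~` B n) (M n x)%:E <=
   \int[mu]_x (M 0%N x)%:E)%E.
Proof.
have mB k : measurable (B k) by apply: (mF (n := k)); exact: FB.
have mE k : measurable (E k) by apply: (mF (n := k)); exact: FE.
elim: n => [|n IH].
  rewrite -(@integralUI 0 setT (B 0%N) (~` B 0%N))//; last 3 first.
  - exact: measurableC.
  - exact: setUv.
  - exact: setICr.
  by rewrite leeD2r// cE_le// /B big_ord1.
have BS : B n.+1 = B n `|` E n.+1 by rewrite /B big_ord_recr.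
apply: le_trans IH; pose D := E n.+1 `\` B n.
have mD : measurable D by exact: measurableD.
have -> : mu (B n.+1) = (mu (B n) + mu D)%E.
  rewrite -measureU//.
    by congr (mu _); rewrite BS /D setDE setUIr setUv setIT.
  by rewrite /D setDE setICA setICr setI0.
rewrite ge0_muleDr// -addeA leeD2l//.
have FC : F n (~` B n).
  by apply/(measurable_subE (sF _))/measurableC/(measurable_subE (sF _)).
apply: le_trans (M_super FC).
rewrite -(@integralUI n.+1 (~` B n) D (~` B n.+1))//; last 3 first.
- exact: measurableC.
- rewrite BS setCU /D setDE [E _ `&` _]setIC -setIUr setUv setIT//.
- by rewrite BS setCU /D setDE [X in _ `&` X]setIC setIACA setICr set0I.
by rewrite leeD2r// cE_le// => x [].
Qed.

Lemma supermartingale_maximal_inequality :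
  (c%:E * mu (\bigcup_n [set x | (c <= M n x)%R]) <= \int[mu]_x (M 0%N x)%:E)%E.
Proof.
have mB k : measurable (B k) by apply: (mF (n := k)); exact: FB.
rewrite -(bigcup_bigsetU_bigcup E).
have cB :
    (fun n => c%:E * mu (B n))%E @ \oo --> (c%:E * mu (\bigcup_n B n))%E.
  apply: cvgeZl => //; apply: nondecreasing_cvg_mu => //.
    exact: bigcup_measurable.
  move=> m n mn; apply/subsetPset; exact: subset_bigsetU.
apply: (cvge_to_le cB); apply: nearW => n; apply: le_trans (stopped_bound n).
by rewrite leeDl// integral_ge0// => x _; rewrite lee_fin.
Qed.

End maximal_inequality.

(** * The conditional exponential bound *)

(** The value at [x = a] of [(e^(lx) - 1 - lx) / x^2], which is also its
    supremum over [0 < |x| <= a] when [l >= 0]. *)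
Definition bennett_coef (R : realType) (a l : R) : R :=
  (expR (l * a) - 1 - l * a) / a ^+ 2.

Section conditional_expectation.
Context (R : realType) (d : measure_display) (T : measurableType d).
Variables (P : probability T R) (G : set_system T).
Hypothesis mG : G `<=` measurable.

(** The set where [Y] is negative belongs to [G], so that [X] and [Y] have the
    same, hence nonnegative, integral over it; it is therefore negligible. *)
Lemma is_cond_exp_ge0 (X Y : T -> R) : is_cond_exp P G X Y ->
  (forall x, 0 <= X x) -> \forall x \ae P, 0 <= Y x.
Proof.
move=> [iX wY iY XY] X0; pose A := Y @^-1` `]-oo, 0[.
have GA : G A by apply: wY; exact: measurable_itv.
have mA := mG GA.
have AY x : A x -> (Y x < 0)%R by rewrite /A/= in_itv.
have mYA : measurable_fun A (EFin \o Y).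
  by apply: measurable_funTS; exact: measurable_int iY.
have YA0 : (\int[P]_(x in A) `|(EFin \o Y) x| = 0)%E.
  apply/eqP; rewrite eq_le integral_ge0// andbT.
  have -> : (\int[P]_(x in A) `|(EFin \o Y) x| = - \int[P]_(x in A) (Y x)%:E)%E.
    rewrite -integralN; last first.
      apply: integrable_add_def => //.
      by apply: integrableS iY => //; exact: subsetT.
    apply: eq_integral => x; rewrite inE => /AY Yx.
    by rewrite /= ltr0_norm.
  rewrite oppe_le0 XY// integral_ge0// => x _; by rewrite lee_fin.
have := (ae_eq_integral_abs P mA mYA).1 YA0.
apply: filterS => x AY0; rewrite leNgt; apply/negP => Yx.
have Ax : A x by rewrite /A/= in_itv.
by have [Yx0] := AY0 Ax; rewrite Yx0 ltxx in Yx.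
Qed.

(** Linearity of conditional expectation, for the polynomial that bounds
    [e^(lu)]. *)
Lemma is_cond_exp_quad (u v w : T -> R) (l p : R) (A : set T) :
  is_cond_exp P G u v -> is_cond_exp P G (fun x => u x ^+ 2) w -> G A ->
  [/\ P.-integrable A (fun x => (1 + l * u x + p * u x ^+ 2)%:E),
      P.-integrable A (fun x => (1 + l * v x + p * w x)%:E) &
      (\int[P]_(x in A) (1 + l * u x + p * u x ^+ 2)%:E =
       \int[P]_(x in A) (1 + l * v x + p * w x)%:E)%E].
Proof.
move=> [iu _ iv uv] [iu2 _ iw uw] GA; have mA := mG GA.
have iS (Z : T -> R) : P.-integrable setT (EFin \o Z) ->
    P.-integrable A (EFin \o Z).
  by move=> iZ; apply: integrableS iZ => //; exact: subsetT.
have i1 := finite_measure_integrable_cst P 1 mA.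
have iZ (k : R) (Z : T -> R) : P.-integrable setT (EFin \o Z) ->
    P.-integrable A (fun x => k%:E * (Z x)%:E)%E.
  by move=> /iS; exact: integrableZl.
have E (X Y : T -> R) : (fun x => (1 + l * X x + p * Y x)%:E) =
    (fun x => 1%:E + l%:E * (X x)%:E + p%:E * (Y x)%:E)%E.
  by apply/funext => x; rewrite !EFinD !EFinM.
have intE (X Y : T -> R) : P.-integrable setT (EFin \o X) ->
    P.-integrable setT (EFin \o Y) ->
    P.-integrable A (fun x => (1 + l * X x + p * Y x)%:E) /\
    (\int[P]_(x in A) (1 + l * X x + p * Y x)%:E = \int[P]_(x in A) 1 +
      l%:E * \int[P]_(x in A) (X x)%:E + p%:E * \int[P]_(x in A) (Y x)%:E)%E.
  move=> iX iY; rewrite E; split.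
    by apply: integrableD (iZ _ _ iY) => //; exact: integrableD (iZ _ _ iX).
  rewrite integralD//; last 2 first.
  - by apply: integrableD (iZ _ _ iX).
  - exact: iZ.
  rewrite integralD//; last exact: iZ.
  rewrite !integralZl//; by [exact: (iS X)|exact: (iS Y)].
have [iL ->] := intE _ _ iu iu2; have [iR ->] := intE _ _ iv iw.
by split => //; rewrite uv// uw.
Qed.

(** The conditional expectation of [e^(lu)] is compared with that of the
    quadratic bound, and the latter with an exponential through
    [1 + y <= e^y]. *)
Lemma integral_expR_le_cond_exp (u v w : T -> R) (a l : R) (A : set T) :
  0 < a -> 0 <= l ->
  is_cond_exp P G u v -> is_cond_exp P G (fun x => u x ^+ 2) w ->
  (\forall x \ae P, `|u x| <= a) -> G A ->
  (\int[P]_(x in A) (expR (l * u x))%:E <=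
   \int[P]_(x in A) (expR (l * v x + bennett_coef a l * w x))%:E)%E.
Proof.
move=> a0 l0 cu cw ua GA; set p := bennett_coef a l; have mA := mG GA.
have [iX iY XY] := is_cond_exp_quad l p cu cw GA.
have [iu _ iv _] := cu; have [_ _ iw _] := cw.
have mu : measurable_fun setT u by exact/measurable_EFinP/(measurable_int P).
have mv : measurable_fun setT v by exact/measurable_EFinP/(measurable_int P).
have mw : measurable_fun setT w by exact/measurable_EFinP/(measurable_int P).
set X := (fun x => (_ + p * u x ^+ 2)%:E) in iX.
set Y := (fun x => (_ + p * w x)%:E) in iY.
have uX : \forall x \ae P, ((expR (l * u x))%:E <= X x)%E.
  apply: filterS ua => x ux; rewrite lee_fin.
  have := expR_quad_le l0 ux; rewrite mulrC -ler_pdivlMr ?exprn_gt0//.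
  by rewrite mulrC mulrA /p /bennett_coef => ?; lra.
have mlu : measurable_fun A (fun x => (expR (l * u x))%:E).
  apply/measurable_EFinP/measurable_funTS; apply: measurableT_comp => //.
  exact: measurable_funM.
(* [X] and [Y] may be negative at some points; their positive parts make the
   monotonicity of the integral of nonnegative functions available. *)
apply: (@le_trans _ _ (\int[P]_(x in A) (X^\+ x))%E).
  apply: ae_ge0_le_integral => //.
  - exact/measurable_funepos/(measurable_int P).
  - by apply: filterS uX => x uX _; rewrite funeposE le_max uX.
have -> : (\int[P]_(x in A) X^\+ x = \int[P]_(x in A) X x)%E.
  apply: ae_eq_integral => //.
  - exact/measurable_funepos/(measurable_int P).
  - exact: (measurable_int P).
  - apply: filterS uX => x uX _; rewrite funeposE max_l//.
    by apply: le_trans uX; rewrite lee_fin expR_ge0.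
rewrite XY.
apply: (@le_trans _ _ (\int[P]_(x in A) (Y^\+ x))%E).
  apply: le_integral => //; first exact: integrable_funepos.
  by move=> x _; rewrite funeposE le_max lexx.
apply: ge0_le_integral => //.
- exact/measurable_funepos/(measurable_int P).
- apply/measurable_EFinP/measurable_funTS; apply: measurableT_comp => //.
  by apply: measurable_funD; exact: measurable_funM.
- move=> x _; rewrite funeposE ge_max !lee_fin expR_ge0 andbT.
  by rewrite -addrA expR_ge1Dx.
Qed.

End conditional_expectation.

(** * The exponential supermartingale *)

Lemma bennett_coef_ge0 (R : realType) (a l : R) : 0 <= bennett_coef a l.
Proof.
rewrite divr_ge0// ?sqr_ge0//; have := expR_ge1Dx (l * a); lra.
Qed.

Section exponential_supermartingale.
Context (R : realType) (d : measure_display) (T : measurableType d).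
Variables (P : probability T R) (F : nat -> set_system T).
Hypothesis hF : filtration F.
Variable f : nat -> T -> R.
Hypotheses (f_adapted : forall n, measurable_wrt (F n) (f n))
  (f0 : forall x, f 0%N x = 0).
Variables u v w : nat -> T -> R.
Hypotheses
  (uv : forall n, is_cond_exp P (F n) (u n.+1) (v n.+1))
  (uw : forall n, is_cond_exp P (F n) (fun x => u n.+1 x ^+ 2) (w n.+1))
  (fE : forall n, \forall x \ae P, f n.+1 x - f n x = u n.+1 x - v n.+1 x).
Variables a l : R.
Hypotheses (a0 : 0 < a) (l0 : 0 <= l)
  (ua : forall n, \forall x \ae P, `|u n.+1 x| <= a).

Let p := bennett_coef a l.
Let sF n : sigma_algebra [set: T] (F n). Proof. by have [+ _ _] := hF. Qed.
Let mF n : F n `<=` measurable. Proof. by have [_ + _] := hF. Qed.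

Definition exp_supermartingale n x :=
  expR (l * f n x - p * \sum_(i < n) w i.+1 x).
Local Notation M := exp_supermartingale.

Let mw n : measurable_fun [set: g_sigma_algebraType (F n)]
  (fun x => \sum_(i < n) w i.+1 x).
Proof.
elim: n => [|n IH].
  by under eq_fun do rewrite big_ord0; exact: measurable_cst.
under eq_fun do rewrite big_ord_recr/=; apply/(measurable_wrtP _ (sF _)).
(* Every term of the sum is measurable for [F n], hence for [F n.+1]. *)
have [_ _ FS] := hF; move=> B mB; apply: FS; move: B mB.
apply/(measurable_wrtP _ (sF _)); apply: measurable_funD => //.
by apply/(measurable_wrtP _ (sF _)); have [] := uw n.
Qed.

Let mM n : measurable_fun [set: g_sigma_algebraType (F n)] (M n).
Proof.
apply: measurableT_comp => //; apply: measurable_funB.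
  by apply: measurable_funM => //; exact: (measurable_wrtP _ (sF n)).1 _.
exact: measurable_funM.
Qed.

(** [M n.+1 = Z e^(l u_(n+1))] almost everywhere and [M n = Z Y], where
    [Y = e^(l v_(n+1) + p w_(n+1))] bounds the conditional expectation of
    [e^(l u_(n+1))] and [Z] is [F n]-measurable. *)
Lemma exp_supermartingale_super n A : F n A ->
  (\int[P]_(x in A) (M n.+1 x)%:E <= \int[P]_(x in A) (M n x)%:E)%E.
Proof.
move=> FA; have mA := mF FA.
have [_ wv iv _] := uv n; have [_ ww iw _] := uw n; have [iu _ _ _] := uv n.
have mv := (measurable_wrtP _ (sF n)).1 wv.
have mw1 := (measurable_wrtP _ (sF n)).1 ww.
have mA' : measurable (A : set (g_sigma_algebraType (F n))).
  exact/(measurable_subE (sF n)).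
pose X x := expR (l * u n.+1 x).
pose Y x := expR (l * v n.+1 x + p * w n.+1 x).
pose Z x := \1_A x * (M n x / Y x).
have mY : measurable_fun [set: g_sigma_algebraType (F n)] Y.
  apply: measurableT_comp => //.
  by apply: measurable_funD; exact: measurable_funM.
have mX : measurable_fun [set: T] X.
  apply: measurableT_comp => //; apply: measurable_funM => //.
  exact/measurable_EFinP/(measurable_int P).
have mZ : measurable_fun [set: g_sigma_algebraType (F n)] Z.
  apply: measurable_funM; first exact: measurable_indic.
  have -> : (fun x => M n x / Y x) = (fun x => M n x *
     expR (- (l * v n.+1 x + p * w n.+1 x))).
    by apply/funext => x; rewrite expRN.
  apply: measurable_funM => //; apply: measurableT_comp => //.
  apply: measurableT_comp => //.
  by apply: measurable_funD; exact: measurable_funM.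
have := @ge0_integral_mul_le_sub _ _ _ P _ (sF n) (mF (n := n)) X Y Z.
have restrictE (g : T -> R) :
    (\int[P]_(x in A) (g x)%:E = \int[P]_x (\1_A x * g x)%:E)%E.
  rewrite [LHS]integral_mkcond epatch_indic.
  by apply: eq_integral => x _; rewrite /= -EFinM mulrC.
have <- : (\int[P]_(x in A) (M n.+1 x)%:E = \int[P]_x (Z x * X x)%:E)%E.
  rewrite restrictE; apply: ae_eq_integral => //.
  - apply/measurable_EFinP; apply: measurable_funM.
      exact: measurable_indic.
    exact: (sub_measurable_fun (sF n.+1) (mF (n := n.+1)) (@mM n.+1)).
  - apply/measurable_EFinP; apply: measurable_funM => //.
    exact: (sub_measurable_fun (sF n) (mF (n := n)) mZ).
  apply: filterS (fE n) => x fx _; rewrite /Z -!mulrA; congr (_ * _)%:E.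
  rewrite /M /X /Y -expRN -!expRD big_ord_recr/=; congr expR.
  have -> : f n.+1 x = f n x + (u n.+1 x - v n.+1 x) by rewrite -fx; ring.
  ring.
have <- : (\int[P]_(x in A) (M n x)%:E = \int[P]_x (Z x * Y x)%:E)%E.
  rewrite restrictE; apply: eq_integral => x _; congr _%:E.
  by rewrite /Z -!mulrA mulVf ?mulr1// gt_eqF// expR_gt0.
apply => //.
- by move=> x; exact: expR_ge0.
- by move=> x; exact: expR_ge0.
- exact: (sub_measurable_fun (sF n) (mF (n := n)) mY).
- move=> B FB.
  exact: (integral_expR_le_cond_exp (mF (n := n)) a0 l0 (uv n) (uw n) (ua n)).
- by move=> x; rewrite mulr_ge0// divr_ge0// expR_ge0.
Qed.

Lemma exp_supermartingale_maximal (c : R) : 0 < c ->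
  (P (\bigcup_n [set x | (c <= M n x)%R]) <= c^-1%:E)%E.
Proof.
move=> c0.
have M0 n x : 0 <= M n x by exact: expR_ge0.
have aM n : measurable_wrt (F n) (M n) by exact/(measurable_wrtP _ (sF n)).
have := supermartingale_maximal_inequality hF M0 aM exp_supermartingale_super
  (ltW c0).
have -> : (\int[P]_x (M 0%N x)%:E = 1)%E.
  under eq_integral do rewrite /M f0 big_ord0 !mulr0 subr0 expR0.
  rewrite (integral_cst _ _ 1)// mul1e; exact: probability_setT.
by rewrite muleC -lee_pdivlMr// mul1e.
Qed.

Variables (b2 r : R).
Hypothesis wb : \forall x \ae P, forall n, \sum_(i < n) w i.+1 x <= b2.

(** Where [sup_pos f x >= r] the supremum may fail to be attained, but for every
    [s < r] some [f n x] exceeds [s]; the bound for [s] is then made to tend to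
    the one for [r]. *)
Lemma exponential_tail_bound :
  (P [set x | r%:E <= sup_pos f x] <= (expR (p * b2 - l * r))%:E)%E.
Proof.
have mf n : measurable_fun setT (f n).
  apply: (sub_measurable_fun (sF n) (mF (n := n))).
  exact: (measurable_wrtP _ (sF n)).1 _.
pose S := [set x | (r%:E <= sup_pos f x)%E].
have mS : measurable S.
  have supE : sup_pos f = (fun x => esups (fun n => (f n x)%:E) 0%N).
    apply/funext => x; rewrite /sup_pos /esups /sdrop; congr ereal_sup.
    by apply/seteqP; split => y [n _ <-]; exists n.
  rewrite /S supE -[X in measurable X]setTI.
  apply: emeasurable_fun_c_infty => //.
  by apply: measurable_fun_esups => n; exact/measurable_EFinP.
have tail s : s < r -> (P S <= (expR (p * b2 - l * s))%:E)%E.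
  move=> sr; have [N [mN PN wN]] := wb.
  pose c := expR (l * s - p * b2).
  have mE n : measurable [set x | (c <= M n x)%R].
    have -> : [set x | (c <= M n x)%R] = setT `&` M n @^-1` `[c, +oo[.
      by apply/seteqP; split=> x /=; rewrite in_itv/= andbT => // -[].
    by apply: (sub_measurable_fun (sF _) (mF (n := n)) (@mM n)).
  have mU : measurable (\bigcup_n [set x | (c <= M n x)%R]).
    exact: bigcup_measurable.
  have SU : S `<=` (\bigcup_n [set x | (c <= M n x)%R]) `|` N.
    move=> x Sx; have [Nx|Nx] := pselect (N x); [by right|left].
    have wx : forall n, \sum_(i < n) w i.+1 x <= b2.
      by apply: contrapT => nw; apply: Nx; apply: wN.
    have : (s%:E < sup_pos f x)%E by apply: lt_le_trans Sx; rewrite lte_fin.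
    move=> /ereal_sup_gt[_ [n _ <-]]; rewrite lte_fin => sf.
    exists n => //=; rewrite ler_expR lerB//.
      by rewrite ler_wpM2l// ltW.
    by rewrite ler_wpM2l// bennett_coef_ge0.
  apply: le_trans (le_measure P _ _ SU) _; rewrite ?inE//.
    exact: measurableU.
  apply: le_trans (measureU2 _ mU mN) _.
  rewrite [X in (_ + X)%E](_ : _ = 0%E); last exact: PN.
  rewrite adde0.
  have := exp_supermartingale_maximal (expR_gt0 (l * s - p * b2)).
  by rewrite -expRN opprB.
have PS : P S \is a fin_num by exact: fin_num_measure.
rewrite -/S -(fineK PS) lee_fin.
pose e n : R := expR (p * b2 - l * (r - n.+1%:R^-1)).
have ecvg : e n @[n --> \oo] --> expR (p * b2 - l * (r - 0)).
  have acvg : (p * b2 - l * (r - n.+1%:R^-1)) @[n --> \oo] -->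
      p * b2 - l * (r - 0).
    apply: cvgB; first exact: cvg_cst.
    apply: cvgM; first exact: cvg_cst.
    by apply: cvgB; [exact: cvg_cst | exact: cvg_harmonic].
  rewrite /e; exact: (cvg_comp _ expR acvg (@continuous_expR R _)).
rewrite subr0 in ecvg; apply: (cvgr_to_ge ecvg); apply: nearW => n.
rewrite -lee_fin fineK//; apply: tail.
by rewrite ltrBlDr ltrDl invr_gt0.
Qed.

End exponential_supermartingale.

(** * The choice of the parameter *)

(** The parameter minimises [l |-> bennett_coef a l * b ^+ 2 - l * r]: the
    derivative vanishes when [e^(la) = 1 + ra / b^2]. *)
Lemma bennett_exponentE (R : realType) (a b r : R) : 0 < a -> 0 < b -> 0 <= r ->
  bennett_coef a (ln (1 + r * a / b ^+ 2) / a) * b ^+ 2 -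
    ln (1 + r * a / b ^+ 2) / a * r =
  r / a - (r / a + b ^+ 2 / a ^+ 2) * ln (1 + r * a / b ^+ 2).
Proof.
move=> a0 b0 r0; set l := ln _ / a; have y0 : 0 <= r * a / b ^+ 2.
  by rewrite divr_ge0 ?sqr_ge0// mulr_ge0// ltW.
have la : l * a = ln (1 + r * a / b ^+ 2) by rewrite /l divfK// gt_eqF.
rewrite /bennett_coef la lnK ?posrE; last lra.
rewrite /l; set L := ln _; field; by rewrite !gt_eqF.
Qed.

(** With [y = r / a], [c = b^2 / a^2] and [z = y / c], the claim is
    [(y + c) ln (1 + z) >= y ln z], and both [c ln (1 + z)] and
    [ln (1 + z) - ln z] are nonnegative. *)
Lemma bennett_le_powR (R : realType) (a b r : R) : 0 < a -> 0 < b -> 0 <= r ->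
  expR (r / a - (r / a + b ^+ 2 / a ^+ 2) * ln (1 + r * a / b ^+ 2)) <=
    (if r == 0 then 1 else (expR 1 * b ^+ 2 / (r * a)) `^ (r / a)).
Proof.
move=> a0 b0 r0; have [->|rn0] := eqVneq r 0.
  by rewrite !mul0r addr0 ln1 mulr0 subr0 expR0.
have {rn0}r0 : 0 < r by rewrite lt_def rn0.
have z0 : 0 < r * a / b ^+ 2 by rewrite divr_gt0 ?exprn_gt0// mulr_gt0.
set z := r * a / b ^+ 2 in z0 *.
have -> : expR 1 * b ^+ 2 / (r * a) = expR (1 - ln z).
  rewrite expRD expRN lnK// /z; field.
  by rewrite !gt_eqF.
rewrite -expRM ler_expR.
have lnz : ln z <= ln (1 + z) by rewrite ler_ln ?posrE; lra.
have ln0 : 0 <= ln (1 + z) by apply: ln_ge0; lra.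
have y0 : 0 <= r / a by rewrite divr_ge0// ltW.
have c0 : 0 <= b ^+ 2 / a ^+ 2 by rewrite divr_ge0// sqr_ge0.
have h1 : r / a * ln z <= r / a * ln (1 + z) by rewrite ler_wpM2l.
have h2 : 0 <= b ^+ 2 / a ^+ 2 * ln (1 + z) by rewrite mulr_ge0.
lra.
Qed.

(** * The tail bound *)

Theorem theorem8p7 (R : realType) (d : measure_display) (T : measurableType d)
  (P : probability T R) (F : nat -> set_system T) (f : nat -> T -> R)
  (hF : filtration F) (hf : martingale P F f)
  (hf0 : forall x, f 0%N x = 0)
  (u v w : nat -> T -> R)
  (hu : forall j, (1 <= j)%N -> P.-integrable [set: T] (EFin \o u j))
  (hv : forall j, (1 <= j)%N -> is_cond_exp P (F j.-1) (u j) (v j))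
  (hw : forall j, (1 <= j)%N ->
     is_cond_exp P (F j.-1) (fun x => u j x ^+ 2) (w j))
  (hd : forall j, (1 <= j)%N ->
     \forall x \ae P, f j x - f j.-1 x = u j x - v j x)
  (a b : R) (ha : 0 < a) (hb : 0 < b)
  (hua : ('N[P]_+oo[sup_abs1 u] <= a%:E)%E)
  (hwb : ('N[P]_+oo[(fun x => \sum_(1 <= j <oo) (w j x)%:E)] <= (b ^+ 2)%:E)%E)
  (r : R) (hr : 0 <= r) :
  (P [set x | r%:E <= sup_pos f x] <=
     (expR (r / a - (r / a + b ^+ 2 / a ^+ 2) * ln (1 + r * a / b ^+ 2)))%:E)%E
  /\
  expR (r / a - (r / a + b ^+ 2 / a ^+ 2) * ln (1 + r * a / b ^+ 2)) <=
    (if r == 0 then 1 else (expR 1 * b ^+ 2 / (r * a)) `^ (r / a)).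
Proof.
split; last exact: bennett_le_powR.
have [af _ _] := hf.
have LnormP (g : T -> \bar R) y : ('N[P]_+oo[g] <= y)%E ->
    \forall x \ae P, (g x <= y)%E.
  have P0 : (0 < P [set: T])%E by rewrite probability_setT lte01.
  rewrite unlock P0 => /ess_supP.
  by apply: filterS => x /=; apply: le_trans; exact: lee_abs.
have ua n : \forall x \ae P, `|u n.+1 x| <= a.
  apply: filterS (LnormP _ _ hua) => x; rewrite -lee_fin; apply: le_trans.
  by apply: ereal_sup_ubound; exists n.+1.
have w0 : \forall x \ae P, forall n, 0 <= w n.+1 x.
  apply: ae_foralln => n; have [sF mF _] := hF.
  have := is_cond_exp_ge0 (mF n) (hw n.+1 (ltn0Sn n)).
  by apply=> x; exact: sqr_ge0.
have wb : \forall x \ae P, forall n, \sum_(i < n) w i.+1 x <= b ^+ 2.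
  apply: filterS2 w0 (LnormP _ _ hwb) => x w0 wb n.
  rewrite -lee_fin; apply: le_trans wb.
  apply: le_trans (nneseries_lim_ge n.+1 _) => [|[//|k] _ _]; last first.
    by rewrite lee_fin.
  by rewrite big_add1 big_mkord/= sumEFin.
rewrite -(bennett_exponentE ha hb hr).
apply: (exponential_tail_bound hF af hf0 (fun n => hv n.+1 (ltn0Sn n))
  (fun n => hw n.+1 (ltn0Sn n)) (fun n => hd n.+1 (ltn0Sn n)) ha _ ua r wb).
apply: divr_ge0; last exact: ltW.
by rewrite ln_ge0// lerDl divr_ge0 ?sqr_ge0// mulr_ge0// ltW.
Qed.
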